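(* Let $\mathbf{S}\in\mathbb{R}^{N\times N}$ be the symmetric graph matrix description of an undirected graph with $N$ nodes, with distinct eigenvalues $\lambda_1,\dots,\lambda_N$ and eigendecomposition $\mathbf{S}=\mathbf{V}\,\mathrm{diag}(\lambda_1,\dots,\lambda_N)\,\mathbf{V}^{T}$, $\mathbf{V}$ orthogonal, and fix $K\ge 0$. Let $\mathbf{x}$ be a random vector in $\mathbb{R}^N$ with mean $\boldsymbol{\mu}_x$ and covariance matrix $\mathbf{C}_x=\mathbb{E}[(\mathbf{x}-\boldsymbol{\mu}_x)(\mathbf{x}-\boldsymbol{\mu}_x)^{T}]$, let $\rho:\mathbb{R}\to\mathbb{R}$ be applied entrywise, $[\rho(\mathbf{x})]_i=\rho(x_i)$, and let $\boldsymbol{\mu}_\rho=\mathbb{E}[\rho(\mathbf{x})]$ with entries $\mu_{\rho i}$; assume $\mathbf{x}$ and $\rho(\mathbf{x})$ have finite second moments. Consider the problem $$\min_{\mathbf{H}\in\mathbb{R}^{N\times(K+1)}}\ \mathbb{E}\Big[\big\|\boldsymbol{H}^{\mathrm{nv}}(\mathbf{S})(\mathbf{x}-\boldsymbol{\mu}_x)-\big(\rho(\mathbf{x})-\boldsymbol{\mu}_\rho\big)\big\|_2^2\Big],\qquad \boldsymbol{H}^{\mathrm{nv}}(\mathbf{S})=\sum_{k=0}^{K}\mathrm{diag}(\mathbf{h}^{(k)})\mathbf{S}^k,$$ where $\mathbf{h}^{(k)}\in\mathbb{R}^N$ is the $(k+1)$-th column of $\mathbf{H}$. Let $\mathbf{u}_i\in\mathbb{R}^N$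 denote the $i$-th row of $\mathbf{V}$, let $\boldsymbol{\Lambda}\in\mathbb{R}^{N\times(K+1)}$ have entries $[\boldsymbol{\Lambda}]_{ik}=\lambda_i^{k-1}$, and set $$\mathbf{R}_i=\boldsymbol{\Lambda}^{T}\mathrm{diag}(\mathbf{u}_i)\mathbf{V}^{T}\mathbf{C}_x\mathbf{V}\,\mathrm{diag}(\mathbf{u}_i)\boldsymbol{\Lambda},\qquad \mathbf{p}_i=\boldsymbol{\Lambda}^{T}\mathrm{diag}(\mathbf{u}_i)\mathbf{V}^{T}\,\mathbb{E}\big[(\rho(x_i)-\mu_{\rho i})(\mathbf{x}-\boldsymbol{\mu}_x)\big].$$ Then a set of filter taps $\{\mathbf{h}_1^{\star},\dots,\mathbf{h}_N^{\star}\}\subset\mathbb{R}^{K+1}$ (the rows of a matrix $\mathbf{H}^{\star}\in\mathbb{R}^{N\times(K+1)}$) is optimal for this problem if and only if it solves the system of linear equations $$\mathbf{R}_i\mathbf{h}_i^{\star}=\mathbf{p}_i,\qquad i\in\{1,\dots,N\}.$$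
   Context: A graph matrix description (GMD) of a graph with nodes $v_1,\dots,v_N$ and edge set $\mathcal{E}$ is a matrix $\mathbf{S}\in\mathbb{R}^{N\times N}$ with $[\mathbf{S}]_{ij}=0$ for all distinct $i,j$ such that $(v_j,v_i)\notin\mathcal{E}$. Since the graph is undirected, $\mathbf{S}$ is assumed symmetric; its eigenvalues are assumed distinct throughout. $\mathrm{diag}(\mathbf{a})$ is the diagonal matrix with the vector $\mathbf{a}$ on its diagonal. The matrix $\boldsymbol{H}^{\mathrm{nv}}(\mathbf{S})$ is the node-variant graph filter with filter taps $\mathbf{H}$; the $i$-th row $\mathbf{h}_i\in\mathbb{R}^{K+1}$ of $\mathbf{H}$ (viewed as a column vector) contains the taps used by node $v_i$. Rows $\mathbf{u}_i$ are likewise viewed as column vectors. *)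

(* Defs.v *)
From HB Require Import structures.
From mathcomp Require Import all_boot all_order all_algebra.
From mathcomp Require Import all_classical all_reals all_analysis.

Set Implicit Arguments.
Unset Strict Implicit.
Unset Printing Implicit Defensive.

Import Order.TTheory GRing.Theory Num.Theory.
Import numFieldNormedType.Exports.

Local Open Scope classical_set_scope.
Local Open Scope ring_scope.

Definition undirected (N : nat) (E : {set 'I_N * 'I_N}) : Prop :=
  forall i j : 'I_N, ((i, j) \in E) = ((j, i) \in E).

(* The diagonal of S is unconstrained, as is the presence of loops in E. *)
Definition graph_matrix_description (R : realType) (N : nat)
    (E : {set 'I_N * 'I_N}) (S : 'M[R]_N) : Prop :=
  forall i j : 'I_N, i != j -> (j, i) \notin E -> S i j = 0.

Definition node_variant_filter (R : realType) (N K : nat) (S : 'M[R]_N)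
    (H : 'M[R]_(N, K.+1)) : 'M[R]_N :=
  \sum_(k < K.+1) diag_mx (col k H)^T *m S ^+ k.

(* The norm `|v| that MathComp-Analysis puts on matrices is the max norm. *)
Definition l2norm (R : realType) (N : nat) (v : 'cV[R]_N) : R :=
  Num.sqrt (\sum_(i < N) v i 0 ^+ 2).

(* [fine] sends an infinite expectation to 0; this does not happen for entries
   in Lfun P 1, in particular for products of two entries in Lfun P 2. *)
Definition expectation_mx (d : measure_display) (T : measurableType d)
    (R : realType) (P : probability T R) (m n : nat) (X : T -> 'M[R]_(m, n)) :
    'M[R]_(m, n) :=
  \matrix_(i < m, j < n) fine 'E_P[fun t => X t i j].

Definition covariance_mx (d : measure_display) (T : measurableType d)
    (R : realType) (P : probability T R) (N : nat) (x : T -> 'cV[R]_N) :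
    'M[R]_N :=
  expectation_mx P (fun t =>
    (x t - expectation_mx P x) *m (x t - expectation_mx P x)^T).

(* The coordinates determine the product sigma-algebra on R^N, so entrywise
   membership in Lfun P 2 says both that x is a random vector (membership in
   Lfun includes measurability) and that its second moments are finite. *)
Definition L2_random_vector (d : measure_display) (T : measurableType d)
    (R : realType) (P : probability T R) (N : nat) (x : T -> 'cV[R]_N) : Prop :=
  forall i : 'I_N, (fun t => x t i 0) \in Lfun P 2%:E.

Definition entrywise (R : realType) (rho : R -> R) (N : nat) (v : 'cV[R]_N) :
    'cV[R]_N :=
  \col_(i < N) rho (v i 0).

Definition filter_mse (d : measure_display) (T : measurableType d)
    (R : realType) (P : probability T R) (N K : nat) (S : 'M[R]_N)
    (x : T -> 'cV[R]_N) (rho : R -> R) (H : 'M[R]_(N, K.+1)) : \bar R :=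
  'E_P[fun t =>
    l2norm (node_variant_filter S H *m (x t - expectation_mx P x)
            - (entrywise rho (x t)
               - expectation_mx P (fun s => entrywise rho (x s)))) ^+ 2].

Definition optimal_taps (d : measure_display) (T : measurableType d)
    (R : realType) (P : probability T R) (N K : nat) (S : 'M[R]_N)
    (x : T -> 'cV[R]_N) (rho : R -> R) (Hs : 'M[R]_(N, K.+1)) : Prop :=
  forall H : 'M[R]_(N, K.+1),
    (filter_mse P S x rho Hs <= filter_mse P S x rho H)%E.

(* Column k : 'I_K.+1 is zero-based, so the exponent k here is k - 1 for
   columns numbered from 1. *)
Definition eigenvalue_powers (R : realType) (N K : nat) (lambda : 'rV[R]_N) :
    'M[R]_(N, K.+1) :=
  \matrix_(i < N, k < K.+1) lambda 0 i ^+ k.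

Definition normal_matrix (d : measure_display) (T : measurableType d)
    (R : realType) (P : probability T R) (N K : nat) (lambda : 'rV[R]_N)
    (V : 'M[R]_N) (x : T -> 'cV[R]_N) (i : 'I_N) : 'M[R]_K.+1 :=
  (eigenvalue_powers K lambda)^T *m diag_mx (row i V) *m V^T
    *m covariance_mx P x
    *m V *m diag_mx (row i V) *m eigenvalue_powers K lambda.

Definition normal_rhs (d : measure_display) (T : measurableType d)
    (R : realType) (P : probability T R) (N K : nat) (lambda : 'rV[R]_N)
    (V : 'M[R]_N) (x : T -> 'cV[R]_N) (rho : R -> R) (i : 'I_N) :
    'cV[R]_K.+1 :=
  (eigenvalue_powers K lambda)^T *m diag_mx (row i V) *m V^T
    *m expectation_mx P (fun t =>
         (rho (x t i 0)
          - expectation_mx P (fun s => entrywise rho (x s)) i 0)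
         *: (x t - expectation_mx P x)).

(* Main.v *)
(* In the eigenbasis, the i-th output of the filter is a scalar product
   <h_i, A_i x> with A_i = Lambda^T diag(u_i) V^T, so the mean squared error
   splits into N least-squares problems sharing no unknowns.  For a residual
   e_i, the orthogonality principle says that h_i is optimal iff
   A_i E[e_i (x - mu_x)] = 0, and this vector equals R_i h_i - p_i. *)

Require Import Defs.
From mathcomp Require Import all_boot all_order all_algebra.
From mathcomp Require Import all_classical all_reals all_analysis.
From mathcomp Require Import ring.

Set Implicit Arguments.
Unset Strict Implicit.
Unset Printing Implicit Defensive.

Import Order.TTheory GRing.Theory Num.Theory.
Import numFieldNormedType.Exports.

Local Open Scope classical_set_scope.
Local Open Scope ring_scope.

(** This is the first-order condition for a minimum at [t = 0], in purely algebraic form; it will be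
    applied to the mean squared error along a line. *)
Lemma linear_term_eq0 (R : realFieldType) (a b : R) :
  0 <= b -> (forall t : R, 0 <= t * a + t ^+ 2 * b) -> a = 0.
Proof.
(* The vertex [- a / (2 * b)] fails for [b = 0]; the denominator [b + 1] is always positive and
   still makes the value minus a square. *)
move=> b0 /(_ (- a / (b + 1))).
have b1 : 0 < b + 1 by rewrite ltr_wpDl.
have -> : - a / (b + 1) * a + (- a / (b + 1)) ^+ 2 * b = - (a / (b + 1)) ^+ 2.
  by field; rewrite gt_eqF.
rewrite oppr_ge0 => h.
have /eqP : (a / (b + 1)) ^+ 2 == 0 by rewrite eq_le h sqr_ge0.
by move/eqP; rewrite sqrf_eq0 mulf_eq0 invr_eq0 (gt_eqF b1) orbF => /eqP.
Qed.

Lemma exp_orthogonal_conj (R : comPzRingType) (N : nat) (V : 'M[R]_N)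
    (lambda : 'rV[R]_N) (k : nat) :
  V^T *m V = 1%:M ->
  (V *m diag_mx lambda *m V^T) ^+ k
  = V *m diag_mx (\row_j lambda 0 j ^+ k) *m V^T.
Proof.
move=> VV; elim: k => [|k IHk].
  have -> : diag_mx (\row_j lambda 0 j ^+ 0) = 1%:M :> 'M[R]_N.
    by apply/matrixP => i j; rewrite !mxE expr0.
  by rewrite mulmx1 expr0 (mulmx1C VV).
rewrite exprS IHk -mulmxE !mulmxA -(mulmxA _ V^T V) VV mulmx1.
rewrite -(mulmxA V) mulmx_diag; congr (_ *m diag_mx _ *m _).
by apply/matrixP => i j; rewrite !mxE exprS.
Qed.

(** * Integrability and linearity of expectations of scalars and matrices *)

Section expectation.
Context (d : measure_display) (T : measurableType d) (R : realType)
  (P : probability T R).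

Lemma LfunD (p : \bar R) (f g : T -> R) : (1 <= p)%E ->
  f \in Lfun P p -> g \in Lfun P p -> (fun t => f t + g t) \in Lfun P p.
Proof. by move=> p1; have [_] := Lfun_addr_closed P p1; exact. Qed.

Lemma Lfun_sum (p : \bar R) (I : Type) (r : seq I) (F : I -> T -> R) :
  (1 <= p)%E -> (forall i, F i \in Lfun P p) ->
  (fun t => \sum_(i <- r) F i t) \in Lfun P p.
Proof.
move=> p1 FL; have -> : (fun t => \sum_(i <- r) F i t) = \sum_(i <- r) F i.
  by apply/funext => t; rewrite fct_sumE.
have [L0 LD] := Lfun_addr_closed P p1.
by elim/big_ind : _.
Qed.

(** This is Hölder's inequality with exponents 2 and 2. It makes the second-order expectations below
    finite, so that [fine] loses nothing on them. *)
Lemma Lfun2_mul (f g : T -> R) :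
  f \in Lfun P 2%:E -> g \in Lfun P 2%:E -> (fun t => f t * g t) \in Lfun P 1.
Proof. exact: Lfun2_mul_Lfun1. Qed.

Lemma Lfun2B (f g : T -> R) :
  f \in Lfun P 2%:E -> g \in Lfun P 2%:E ->
  (fun t => f t - g t) \in Lfun P 2%:E.
Proof.
have p1 : (1 <= 2%:E :> \bar R)%E by rewrite lee1n.
move=> fL gL; apply: LfunD => //; exact: Lfun_oppr_closed gL.
Qed.

Lemma Lfun_mull (p : R) (c : R) (f : T -> R) :
  1 <= p -> f \in Lfun P p%:E -> (fun t => c * f t) \in Lfun P p%:E.
Proof.
move=> p1 fL; have -> : (fun t => c * f t) = c \o* f.
  by apply/funext => t /=; rewrite mulrC.
exact: Lfun_scale.
Qed.

Lemma expectation_EFin (f : T -> R) :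
  f \in Lfun P 1 -> ('E_P[f] = (fine 'E_P[f])%:E)%E.
Proof. by move=> /expectation_fin_num /fineK. Qed.

Lemma fine_expectationD (f g : T -> R) : f \in Lfun P 1 -> g \in Lfun P 1 ->
  fine 'E_P[fun t => f t + g t] = fine 'E_P[f] + fine 'E_P[g].
Proof. by move=> fL gL; rewrite expectationD// fineD// expectation_fin_num. Qed.

Lemma fine_expectationB (f g : T -> R) : f \in Lfun P 1 -> g \in Lfun P 1 ->
  fine 'E_P[fun t => f t - g t] = fine 'E_P[f] - fine 'E_P[g].
Proof. by move=> fL gL; rewrite expectationB// fineB// expectation_fin_num. Qed.

Lemma fine_expectationZ (c : R) (f : T -> R) : f \in Lfun P 1 ->
  fine 'E_P[fun t => c * f t] = c * fine 'E_P[f].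
Proof.
move=> fL; have -> : (fun t => c * f t) = c \o* f.
  by apply/funext => t /=; rewrite mulrC.
by rewrite expectationZl// fineM// expectation_fin_num.
Qed.

Lemma fine_expectation_sum (I : Type) (r : seq I) (F : I -> T -> R) :
  (forall i, F i \in Lfun P 1) ->
  fine 'E_P[fun t => \sum_(i <- r) F i t] = \sum_(i <- r) fine 'E_P[F i].
Proof.
move=> FL; elim: r => [|i r IHr].
  rewrite big_nil; under eq_fun do rewrite big_nil.
  by rewrite expectation_cst.
rewrite big_cons; under eq_fun do rewrite big_cons.
by rewrite fine_expectationD// ?IHr//; exact: Lfun_sum.
Qed.

Lemma fine_expectation_sqrD (f g : T -> R) :
  f \in Lfun P 2%:E -> g \in Lfun P 2%:E ->
  fine 'E_P[fun t => (f t + g t) ^+ 2]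
  = fine 'E_P[fun t => f t ^+ 2] + 2 * fine 'E_P[fun t => f t * g t]
    + fine 'E_P[fun t => g t ^+ 2].
Proof.
move=> fL gL; have ffL := Lfun2_mul fL fL; have ggL := Lfun2_mul gL gL.
have fgL := Lfun_mull 2 (lexx 1) (Lfun2_mul fL gL).
rewrite -fine_expectationZ ?Lfun2_mul//.
under eq_fun do rewrite sqrrD -mulr_natl.
rewrite fine_expectationD//; last first.
  exact: LfunD.
by rewrite fine_expectationD.
Qed.

Lemma expectation_mxB (m n : nat) (X Y : T -> 'M[R]_(m, n)) :
  (forall i j, (fun t => X t i j) \in Lfun P 1) ->
  (forall i j, (fun t => Y t i j) \in Lfun P 1) ->
  expectation_mx P (fun t => X t - Y t)
  = expectation_mx P X - expectation_mx P Y.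
Proof.
move=> XL YL; apply/matrixP => i j; rewrite !mxE -fine_expectationB//.
by under eq_fun do rewrite !mxE.
Qed.

Lemma expectation_mx_mull (m n p : nat) (A : 'M[R]_(p, m))
    (X : T -> 'M[R]_(m, n)) :
  (forall i j, (fun t => X t i j) \in Lfun P 1) ->
  expectation_mx P (fun t => A *m X t) = A *m expectation_mx P X.
Proof.
move=> XL; apply/matrixP => i j; rewrite !mxE.
under eq_fun do rewrite !mxE.
rewrite fine_expectation_sum => [|k]; last exact: Lfun_mull.
by apply: eq_bigr => k _; rewrite fine_expectationZ// mxE.
Qed.

Lemma expectation_mx_tr (m n : nat) (X : T -> 'M[R]_(m, n)) :
  expectation_mx P (fun t => (X t)^T) = (expectation_mx P X)^T.
Proof.
by apply/matrixP => i j; rewrite !mxE; under eq_fun do rewrite mxE.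
Qed.

Lemma expectation_mx_mulr (m n p : nat) (A : 'M[R]_(n, p))
    (X : T -> 'M[R]_(m, n)) :
  (forall i j, (fun t => X t i j) \in Lfun P 1) ->
  expectation_mx P (fun t => X t *m A) = expectation_mx P X *m A.
Proof.
move=> XL; apply: trmx_inj; rewrite trmx_mul -!expectation_mx_tr.
rewrite -expectation_mx_mull => [|i j]; last by under eq_fun do rewrite mxE.
by under eq_fun do rewrite trmx_mul.
Qed.

Lemma L2_random_vector_mul (N : nat) (v : 'rV[R]_N) (X : T -> 'cV[R]_N) :
  L2_random_vector P X -> (fun t => (v *m X t) 0 0) \in Lfun P 2%:E.
Proof.
move=> XL; under eq_fun do rewrite mxE.
apply: Lfun_sum => [|i]; first by rewrite lee1n.
by apply: Lfun_mull => //; rewrite ler1n.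
Qed.

Lemma L2_random_vector_center (N : nat) (X : T -> 'cV[R]_N) :
  L2_random_vector P X ->
  L2_random_vector P (fun t => X t - expectation_mx P X).
Proof.
move=> XL i; under eq_fun do rewrite mxE [X in _ + X]mxE.
apply: Lfun2B => //; exact: Lfun_cst.
Qed.

End expectation.

(** * The mean squared error as a quadratic function of the taps *)

Section filter_taps.
Context (d : measure_display) (T : measurableType d) (R : realType)
  (P : probability T R) (N K : nat) (S V : 'M[R]_N) (lambda : 'rV[R]_N)
  (x : T -> 'cV[R]_N) (rho : R -> R).
Hypothesis VV : V^T *m V = 1%:M.
Hypothesis SE : S = V *m diag_mx lambda *m V^T.
Hypothesis xL : L2_random_vector P x.
Hypothesis rhoL : L2_random_vector P (fun t => entrywise rho (x t)).

Implicit Types (H D : 'M[R]_(N, K.+1)) (i : 'I_N).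

Let xc (t : T) : 'cV[R]_N := x t - expectation_mx P x.

Let yc (t : T) : 'cV[R]_N :=
  entrywise rho (x t) - expectation_mx P (fun s => entrywise rho (x s)).

Let xcL : L2_random_vector P xc := L2_random_vector_center xL.

Let ycL : L2_random_vector P yc := L2_random_vector_center rhoL.

(** This is the matrix [A_i]. Its row [k] is the [i]-th row of [S ^+ k], written in the
    eigenbasis. *)
Definition node_basis i : 'M[R]_(K.+1, N) :=
  (eigenvalue_powers K lambda)^T *m diag_mx (row i V) *m V^T.

(** Left multiplication by a diagonal matrix scales entry [i] of [S ^+ k *m v] by [H i k], so only
    the taps of node [i] enter; diagonalising [S ^+ k] then exhibits [A_i]. *)
Lemma node_variant_filterE H i (v : 'cV[R]_N) :
  (node_variant_filter S H *m v) i 0 = (row i H *m node_basis i *m v) 0 0.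
Proof.
rewrite mulmx_suml summxE -!mulmxA mxE; apply: eq_bigr => k _.
rewrite SE exp_orthogonal_conj// -!mulmxA mul_diag_mx !mxE.
congr (_ * _); apply: eq_bigr => j _.
by rewrite !mul_diag_mx !mxE mulrCA.
Qed.

Definition output H i (t : T) : R := (row i H *m node_basis i *m xc t) 0 0.

Definition residual H i (t : T) : R := output H i t - yc t i 0.

Lemma output_Lfun2 H i : output H i \in Lfun P 2%:E.
Proof. exact: L2_random_vector_mul. Qed.

Lemma residual_Lfun2 H i : residual H i \in Lfun P 2%:E.
Proof. by apply: Lfun2B; [exact: output_Lfun2|exact: ycL]. Qed.

Lemma outputZ (a : R) D i t : output (a *: D) i t = a * output D i t.
Proof. by rewrite /output linearZ/= -!scalemxAl mxE. Qed.

Lemma residualD H D i t : residual (H + D) i t = residual H i t + output D i t.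
Proof.
by rewrite /residual /output (linearD (row i))/= !mulmxDl mxE addrAC.
Qed.

Definition mse H : R := \sum_(i < N) fine 'E_P[fun t => residual H i t ^+ 2].

(** Each squared residual is integrable, so the objective is finite and the expectation can be taken
    node by node. Optimality becomes a comparison of real numbers. *)
Lemma filter_mseE H : filter_mse P S x rho H = (mse H)%:E.
Proof.
have rL i : (fun t => residual H i t ^+ 2) \in Lfun P 1.
  by apply: Lfun2_mul; exact: residual_Lfun2.
rewrite /mse -fine_expectation_sum// -expectation_EFin; last exact: Lfun_sum.
rewrite /filter_mse; congr ('E_P[_])%E; apply/funext => t.
rewrite /l2norm sqr_sqrtr; last by apply: sumr_ge0 => i _; exact: sqr_ge0.
apply: eq_bigr => i _; congr (_ ^+ 2).
by rewrite mxE node_variant_filterE; congr (_ + _); rewrite mxE.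
Qed.

(** By [mseDZ], this is half the gradient of [mse] with respect to row [i] of [H]. *)
Definition normal_residual H i : 'cV[R]_K.+1 :=
  normal_matrix P K lambda V x i *m (row i H)^T
  - normal_rhs P K lambda V x rho i.

(** Since [R_i = A_i C_x A_i^T], the factor [A_i] comes out on the left of both terms. The constant
    vector [A_i^T h_i] then moves inside the expectation defining [C_x], where it turns [xc xc^T]
    into [output] times [xc]. *)
Lemma normal_residualE H i :
  normal_residual H i
  = node_basis i *m expectation_mx P (fun t => residual H i t *: xc t).
Proof.
have -> : normal_residual H i = node_basis i *m
    (covariance_mx P x *m (row i H *m node_basis i)^T
     - expectation_mx P (fun t => yc t i 0 *: xc t)).
  rewrite /normal_residual /normal_matrix /normal_rhs mulmxBr.
  congr (_ - _).
    by rewrite !trmx_mul tr_diag_mx !trmxK !mulmxA.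
  congr (_ *m expectation_mx P _); apply/funext => t.
  by rewrite /yc !mxE.
have sL (f : T -> R) (j : 'I_N) (k : 'I_1) : f \in Lfun P 2%:E ->
    (fun t => (f t *: xc t) j k) \in Lfun P 1.
  move=> fL; rewrite ord1; under eq_fun do rewrite mxE.
  exact: Lfun2_mul fL (xcL j).
congr (_ *m _); rewrite -expectation_mx_mulr => [|j k]; last first.
  under eq_fun do rewrite mxE big_ord1 [_^T _ _]mxE.
  by apply: Lfun2_mul; exact: xcL.
have -> : (fun t => xc t *m (xc t)^T *m (row i H *m node_basis i)^T)
    = fun t => output H i t *: xc t.
  apply/funext => t; rewrite -mulmxA -trmx_mul.
  apply/matrixP => j k; rewrite (ord1 k) mxE big_ord1 [_^T _ _]mxE.
  by rewrite [RHS]mxE mulrC.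
rewrite -expectation_mxB; last 2 first.
- by move=> j k; apply: sL; exact: output_Lfun2.
- by move=> j k; apply: sL; exact: ycL.
by congr expectation_mx; apply/funext => t; rewrite scalerBl.
Qed.

Lemma expectation_residual_output H D i :
  fine 'E_P[fun t => residual H i t * output D i t]
  = (row i D *m normal_residual H i) 0 0.
Proof.
rewrite normal_residualE mulmxA -expectation_mx_mull => [|j k]; last first.
  rewrite ord1; under eq_fun do rewrite mxE.
  by apply: Lfun2_mul; [exact: residual_Lfun2|exact: xcL].
rewrite mxE; congr (fine 'E_P[_])%E; apply/funext => t.
by rewrite -scalemxAr mxE.
Qed.

(** The residual is affine in the taps with linear part [output], so this second-order expansion is
    exact; the cross term is given by [expectation_residual_output]. *)
Lemma mseDZ H D (a : R) :
  mse (H + a *: D)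
  = mse H + (a * (2 * \sum_(i < N) (row i D *m normal_residual H i) 0 0)
             + a ^+ 2 * \sum_(i < N) fine 'E_P[fun t => output D i t ^+ 2]).
Proof.
rewrite !mulr_sumr -!big_split/=; apply: eq_bigr => i _.
have sqrZ : fine 'E_P[fun t => output (a *: D) i t ^+ 2]
    = a ^+ 2 * fine 'E_P[fun t => output D i t ^+ 2].
  rewrite -fine_expectationZ; last by apply: Lfun2_mul; exact: output_Lfun2.
  by under eq_fun do rewrite outputZ exprMn.
under eq_fun do rewrite residualD.
rewrite fine_expectation_sqrD ?output_Lfun2 ?residual_Lfun2//.
rewrite expectation_residual_output sqrZ linearZ/= -scalemxAl mxE.
by rewrite -addrA mulrCA.
Qed.

Lemma sqr_output_ge0 D :
  0 <= \sum_(i < N) fine 'E_P[fun t => output D i t ^+ 2].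
Proof.
apply: sumr_ge0 => i _; apply/fine_ge0/expectation_ge0 => t.
exact: sqr_ge0.
Qed.

(** Along every line through [H] the error is a quadratic polynomial with nonnegative leading
    coefficient, so [H] is a minimum exactly when all the linear coefficients vanish. *)
Lemma optimal_taps_normal_residual H :
  optimal_taps P S x rho H <-> forall i, normal_residual H i = 0.
Proof.
split=> [opt|G0 H'].
  (* The first variation vanishes in the direction of the gradient. *)
  pose D := \matrix_(i < N, k < K.+1) normal_residual H i k 0.
  have : 2 * \sum_(i < N) (row i D *m normal_residual H i) 0 0 = 0.
    apply: linear_term_eq0 (sqr_output_ge0 D) _ => a.
    by have := opt (H + a *: D); rewrite !filter_mseE lee_fin mseDZ lerDl.
  (* For this direction the linear coefficient is twice a sum of squares of all entries of the
     gradient, hence its vanishing annihilates each entry. *)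
  have sq i : (row i D *m normal_residual H i) 0 0
      = \sum_k normal_residual H i k 0 ^+ 2.
    by rewrite mxE; apply: eq_bigr => k _; rewrite !mxE.
  have sq0 i : 0 <= \sum_k normal_residual H i k 0 ^+ 2.
    by apply: sumr_ge0 => k _; exact: sqr_ge0.
  under eq_bigr do rewrite sq.
  move=> /eqP; rewrite mulf_eq0 pnatr_eq0/= psumr_eq0// => /allP G0 i.
  have /= := G0 i (mem_index_enum i).
  rewrite psumr_eq0 => [/allP Gi0|k _]; last exact: sqr_ge0.
  apply/matrixP => k l; rewrite ord1 [RHS]mxE.
  by have /= := Gi0 k (mem_index_enum k); rewrite sqrf_eq0 => /eqP.
(* Any competitor lies on a line through [H], at parameter 1; with a zero linear term only the
   nonnegative quadratic term separates the two errors. *)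
have -> : H' = H + 1 *: (H' - H) by rewrite scale1r addrC subrK.
rewrite !filter_mseE lee_fin mseDZ lerDl expr1n !mul1r.
rewrite big1 ?mulr0 ?add0r ?sqr_output_ge0// => i _.
by rewrite G0 mulmx0 mxE.
Qed.

End filter_taps.

Theorem proposition5 (d : measure_display) (T : measurableType d)
    (R : realType) (P : probability T R) (N K : nat)
    (E : {set 'I_N * 'I_N}) (S V : 'M[R]_N) (lambda : 'rV[R]_N)
    (x : T -> 'cV[R]_N) (rho : R -> R) (Hstar : 'M[R]_(N, K.+1)) :
  undirected E ->
  graph_matrix_description E S ->
  S^T = S ->
  V^T *m V = 1%:M ->
  S = V *m diag_mx lambda *m V^T ->
  injective (fun i : 'I_N => lambda 0 i) ->
  L2_random_vector P x ->
  L2_random_vector P (fun t => entrywise rho (x t)) ->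
  optimal_taps P S x rho Hstar <->
  (forall i : 'I_N,
     normal_matrix P K lambda V x i *m (row i Hstar)^T
     = normal_rhs P K lambda V x rho i).
Proof.
move=> _ _ _ VV SE _ xL rhoL.
apply: (iff_trans (optimal_taps_normal_residual VV SE xL rhoL Hstar)).
by split=> h i; apply/eqP; move: (h i) => /eqP; rewrite subr_eq0.
Qed.
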